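(* Let $\mathscr{A}=(a_{i_1i_2i_3i_4})\in\mathbb{T}_{4,2}$ be given by $a_{1122}=a_{2222}=1$, $a_{2112}=-1$ and all other entries $0$, and let $\mathscr{B}=(b_{i_1i_2i_3})\in\mathbb{T}_{3,2}$ be given by $b_{122}=b_{222}=1$, $b_{212}=-1$ and all other entries $0$. Then each of $\mathscr{A}$ and $\mathscr{B}$ is copositive and is a $Q$-tensor, but is not an $R_0$-tensor. Thus the result that for copositive matrices $M\in\mathbb{R}^{n\times n}$ with $n\le 3$ one has $M\in Q\Longleftrightarrow M\in R_0$ cannot be extended to tensors. Moreover, the same conclusion can also be obtained from the following tensors: for odd $m\ge 3$, $\mathscr{C}=(c_{i_1\cdots i_m})\in\mathbb{T}_{m,2}$ with $$c_{\underbrace{1\cdots 1}_{m-i}\underbrace{2\cdots 2}_{i}}=c_{\underbrace{2\cdots 2}_{i+1}\underbrace{1\cdots 1}_{m-1-i}}=(-1)^i\binom{m-1}{i},\quad \forall i\in\{0,1,\ldots,m-1\},$$ and all other entries $0$.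
   Context: $[n]=\{1,\ldots,n\}$, $\mathbb{R}^n_+=\{x\in\mathbb{R}^n:x\ge 0\}$ (componentwise). $\mathbb{T}_{m,n}$ is the set of real $m$-order $n$-dimensional tensors $\mathscr{A}=(a_{i_1\cdots i_m})$, $a_{i_1\cdots i_m}\in\mathbb{R}$ for $i_1,\ldots,i_m\in[n]$ (no symmetry assumed). For $x\in\mathbb{R}^n$, $\mathscr{A}x^{m-1}\in\mathbb{R}^n$ is defined by $(\mathscr{A}x^{m-1})_i=\sum_{i_2,\ldots,i_m=1}^n a_{ii_2\cdots i_m}x_{i_2}\cdots x_{i_m}$, and $\mathscr{A}x^m:=x^T\mathscr{A}x^{m-1}$. $\mathscr{A}$ is copositive if $\mathscr{A}x^m\ge 0$ for all $x\in\mathbb{R}^n_+$. $\mathscr{A}$ is a $Q$-tensor if for every $q\in\mathbb{R}^n$ there is $x\in\mathbb{R}^n$ with $x\ge 0$, $\mathscr{A}x^{m-1}+q\ge 0$, $x^T(\mathscr{A}x^{m-1}+q)=0$. $\mathscr{A}$ is an $R_0$-tensor if there is no $x\in\mathbb{R}^n_+\setminus\{0\}$ such that for all $i\in[n]$: $(\mathscr{A}x^{m-1})_i=0$ if $x_i>0$, and $(\mathscr{A}x^{m-1})_i\ge 0$ if $x_i=0$. For $m=2$ these are the notions of copositive matrix, $Q$-matrix ($M\in Q$) and $R_0$-matrix ($M\in R_0$). *)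

(* Defs.v *)
From HB Require Import structures.
From mathcomp Require Import all_boot all_order all_algebra.
From mathcomp Require Import reals.

Set Implicit Arguments.
Unset Strict Implicit.
Unset Printing Implicit Defensive.

Import Order.TTheory GRing.Theory Num.Theory.

Local Open Scope ring_scope.

(* T_{m,n}: real tensors of order m and dimension n, without symmetry; an
   index (i_1, ..., i_m) is an m-tuple over 'I_n. *)
Definition tensor (R : realType) (m n : nat) := {ffun m.-tuple 'I_n -> R}.

Definition nonneg (R : realType) n (x : 'cV[R]_n) : Prop :=
  forall i, 0 <= x i 0.

(* All notions below are for tensors of order m.+1, so that "x^{m-1}" for a
   tensor of order m becomes x^m: [tens_app A x] is the vector A x^{(m.+1)-1}
   and [tens_form A x] is the scalar A x^{m.+1}. *)
Definition tens_app (R : realType) m n (A : tensor R m.+1 n) (x : 'cV[R]_n) :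
    'cV[R]_n :=
  \col_i \sum_(t : m.-tuple 'I_n)
    A [tuple of i :: t] * \prod_(j < m) x (tnth t j) 0.

Definition tens_form (R : realType) m n (A : tensor R m.+1 n) (x : 'cV[R]_n) :
    R :=
  (x^T *m tens_app A x) 0 0.

Definition copositive (R : realType) m n (A : tensor R m.+1 n) : Prop :=
  forall x : 'cV[R]_n, nonneg x -> 0 <= tens_form A x.

Definition Q_tensor (R : realType) m n (A : tensor R m.+1 n) : Prop :=
  forall q : 'cV[R]_n, exists x : 'cV[R]_n,
    [/\ nonneg x, nonneg (tens_app A x + q)
      & (x^T *m (tens_app A x + q)) 0 0 = 0].

Definition R0_tensor (R : realType) m n (A : tensor R m.+1 n) : Prop :=
  ~ exists x : 'cV[R]_n,
      [/\ nonneg x, x <> 0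
        & forall i, (0 < x i 0 -> tens_app A x i 0 = 0)
                 /\ (x i 0 = 0 -> 0 <= tens_app A x i 0)].

(* For m = 1 (order 2) this is the equivalence Q <-> R_0 for copositive
   n x n matrices with n <= 3; for other m, its analogue in order m.+1. *)
Definition copositive_Q_iff_R0 (R : realType) (m : nat) : Prop :=
  forall n : nat, (0 < n <= 3)%N ->
  forall A : tensor R m.+1 n, copositive A -> (Q_tensor A <-> R0_tensor A).

(* The index tuple written with indices 1, ..., n instead of 0, ..., n - 1. *)
Definition idx m n (t : m.-tuple 'I_n) : seq nat := [seq (val i).+1 | i <- t].

Definition tensA (R : realType) : tensor R 4 2 :=
  [ffun t => if idx t \in [:: [:: 1; 1; 2; 2]; [:: 2; 2; 2; 2]]%N then 1
             else if idx t == [:: 2; 1; 1; 2]%N then -1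
             else 0].

Definition tensB (R : realType) : tensor R 3 2 :=
  [ffun t => if idx t \in [:: [:: 1; 2; 2]; [:: 2; 2; 2]]%N then 1
             else if idx t == [:: 2; 1; 2]%N then -1
             else 0].

Definition idxC1 (m i : nat) : seq nat := nseq (m.+1 - i) 1%N ++ nseq i 2%N.
Definition idxC2 (m i : nat) : seq nat := nseq i.+1 2%N ++ nseq (m - i) 1%N.

(* Order m.+1. At most one i matches a given index: see [tensC_idx1],
   [tensC_idx2] and [tensC_other]. *)
Definition tensC (R : realType) (m : nat) : tensor R m.+1 2 :=
  [ffun t => if [pick i : 'I_m.+1 | (idx t == idxC1 m i) || (idx t == idxC2 m i)]
             is Some i then (-1) ^+ i * 'C(m, i)%:R
             else 0].

Lemma count_idxC1 m i : count_mem 2%N (idxC1 m i) = i.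
Proof. by rewrite count_cat !count_nseq /= mul1n. Qed.

Lemma count_idxC2 m i : count_mem 2%N (idxC2 m i) = i.+1.
Proof. by rewrite count_cat !count_nseq /= mul1n addn0. Qed.

Lemma idxC1_neq2 m (i j : 'I_m.+1) : idxC1 m i <> idxC2 m j.
Proof. by rewrite /idxC1 /idxC2 subSn // -ltnS. Qed.

Lemma tensC_idx1 (R : realType) m (i : 'I_m.+1) (t : m.+1.-tuple 'I_2) :
  idx t = idxC1 m i -> tensC R m t = (-1) ^+ i * 'C(m, i)%:R.
Proof.
move=> ti; rewrite ffunE; case: pickP => [j|/(_ i)]; rewrite ti ?eqxx //.
case/orP=> /eqP; last by move/idxC1_neq2.
by move/(congr1 (count_mem 2%N)); rewrite !count_idxC1 => ->.
Qed.

Lemma tensC_idx2 (R : realType) m (i : 'I_m.+1) (t : m.+1.-tuple 'I_2) :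
  idx t = idxC2 m i -> tensC R m t = (-1) ^+ i * 'C(m, i)%:R.
Proof.
move=> ti; rewrite ffunE; case: pickP => [j|/(_ i)]; rewrite ti ?eqxx ?orbT //.
case/orP=> /eqP; first by move/esym/idxC1_neq2.
by move/(congr1 (count_mem 2%N)); rewrite !count_idxC2 => -[->].
Qed.

Lemma tensC_other (R : realType) m (t : m.+1.-tuple 'I_2) :
  (forall i : 'I_m.+1, idx t <> idxC1 m i /\ idx t <> idxC2 m i) ->
  tensC R m t = 0.
Proof.
move=> nt; rewrite ffunE; case: pickP => // i; have [n1 n2] := nt i.
by case/orP=> /eqP.
Qed.

(* Main.v *)
Require Import Defs.
From mathcomp Require Import all_boot all_order all_algebra.
From mathcomp Require Import reals ring lra.

Set Implicit Arguments.
Unset Strict Implicit.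
Unset Printing Implicit Defensive.

Import Order.TTheory GRing.Theory Num.Theory.

Local Open Scope ring_scope.

(** Writing x = (a, b), one computes
      A x^3 = (a b^2, b^3 - a^2 b),   B x^2 = (b^2, b^2 - a b),
      C x^(m-1) = ((a - b)^(m-1), (a - b)^(m-1)),
    so the forms are b^4, b^3 and (a + b) (a - b)^(m-1), nonnegative on the
    quadrant, and (1, 0), (1, 0), (1, 1) refute R_0.  The complementarity
    problems are solved explicitly with roots; the only coupled case is
    A with q_1 < 0, where b^3 is the positive root of X^2 + q_2 X - q_1^2. *)

(** * Sums over tuples and real roots *)

Lemma sum_tupleS (V : nmodType) (T : finType) m (F : m.+1.-tuple T -> V) :
  \sum_t F t = \sum_i \sum_(t : m.-tuple T) F [tuple of i :: t].
Proof.
rewrite pair_big /= (reindex (fun p : T * m.-tuple T => [tuple of p.1 :: p.2])) //.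
exists (fun t : m.+1.-tuple T => (thead t, [tuple of behead t])) => [[i t]|t] _ /=.
  by congr pair; apply: val_inj.
by rewrite -tuple_eta.
Qed.

Lemma sum_tuple0 (V : nmodType) (T : finType) (F : 0.-tuple T -> V) :
  \sum_t F t = F [tuple].
Proof.
by rewrite (big_pred1 [tuple]) // => t; rewrite [t]tuple0; apply/esym/eqP.
Qed.

(** Terms off the image of [f] vanish, and injectivity prevents double counting. It collapses a row
    of [tensC], a sum over all [m]-tuples, to the [m.+1] terms of a binomial expansion. *)
Lemma sum_support_inj {V : nmodType} {I T : finType} (f : I -> T) (F : T -> V) :
  injective f -> (forall t, (forall i, t != f i) -> F t = 0) ->
  \sum_t F t = \sum_i F (f i).
Proof.
move=> injf F0.
have -> : \sum_t F t = \sum_(t in f @: setT) F t.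
  apply/esym/big_rmcond => t tf; apply: F0 => i.
  by apply: contra tf => /eqP ->; apply: imset_f.
rewrite big_imset /=; last by move=> i j _ _ /injf.
by apply: eq_bigl => i; rewrite inE.
Qed.

(** Intermediate value theorem for X^(k+1) - c on [0, 1 + c]: the right end works because (1 +
    c)^(k+1) >= 1 + c >= c. *)
Lemma nth_root_exists (R : rcfType) k (c : R) :
  0 <= c -> exists2 x, 0 <= x & x ^+ k.+1 = c.
Proof.
move=> c0; have c1 : 0 <= 1 + c by lra.
have [|x /andP[x0 _]] := @poly_ivt _ ('X^(k.+1) - c%:P) 0 (1 + c) c1.
  rewrite !hornerE expr0n /= sub0r oppr_le0 c0 /=.
  rewrite subr_ge0 exprS (le_trans (y := 1 + c)) //; first by lra.
  by rewrite ler_peMr // exprn_ege1 //; lra.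
by rewrite rootE !hornerE subr_eq0 => /eqP xk; exists x.
Qed.

(** * Reduction to two real functions in dimension two *)

Definition vec2 {R : realType} (a b : R) : 'cV[R]_2 :=
  \col_i if i == 0 then a else b.

Lemma ord2P (P : 'I_2 -> Prop) : P 0 -> P 1 -> forall i, P i.
Proof.
by move=> P0 P1 [[|[|//]] lti]; [have -> : Ordinal lti = 0 | have -> : Ordinal lti = 1];
  rewrite //; apply: val_inj.
Qed.

Lemma vec2_0 (R : realType) (a b : R) : vec2 a b 0 0 = a. Proof. by rewrite mxE. Qed.

Lemma vec2_1 (R : realType) (a b : R) : vec2 a b 1 0 = b. Proof. by rewrite mxE. Qed.

Lemma dot2 (R : realType) (x y : 'cV[R]_2) :
  (x^T *m y) 0 0 = x 0 0 * y 0 0 + x 1 0 * y 1 0.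
Proof.
rewrite mxE big_ord_recl big_ord1 !mxE.
by have -> : lift ord0 ord0 = 1 :> 'I_2 by apply: val_inj.
Qed.

(** Once [f] and [g] are known, each tensor property becomes a statement about two functions of two
    real variables. *)
Definition tens_app_is {R : realType} {m} (A : tensor R m.+1 2)
    (f g : R -> R -> R) :=
  forall x, tens_app A x = vec2 (f (x 0 0) (x 1 0)) (g (x 0 0) (x 1 0)).

Lemma tens_appE (R : realType) m n (A : tensor R m.+1 n) x i :
  tens_app A x i 0 =
  \sum_(t : m.-tuple 'I_n) A [tuple of i :: t] * \prod_(j <- t) x j 0.
Proof. by rewrite mxE; apply: eq_bigr => t _; rewrite big_tuple. Qed.

Section DimensionTwo.
Context {R : realType} {m : nat} {A : tensor R m.+1 2} {f g : R -> R -> R}.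
Hypothesis appA : tens_app_is A f g.

Lemma copositive2 :
  (forall a b, 0 <= a -> 0 <= b -> 0 <= a * f a b + b * g a b) -> copositive A.
Proof. by move=> fg x x0; rewrite /tens_form dot2 appA vec2_0 vec2_1; apply: fg. Qed.

Lemma Q_tensor2 :
  (forall p r, exists a b, [/\ 0 <= a /\ 0 <= b, 0 <= f a b + p, 0 <= g a b + r,
     a * (f a b + p) = 0 & b * (g a b + r) = 0]) -> Q_tensor A.
Proof.
move=> fg q; have [a [b [[a0 b0] fp gr afp bgr]]] := fg (q 0 0) (q 1 0).
exists (vec2 a b); split.
- by apply: ord2P; rewrite ?vec2_0 ?vec2_1.
- by apply: ord2P; rewrite mxE appA ?vec2_0 ?vec2_1.
- have addE (y : 'cV[R]_2) i : (y + q) i 0 = y i 0 + q i 0 by rewrite mxE.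
  by rewrite dot2 !addE appA !vec2_0 !vec2_1 afp bgr addr0.
Qed.

(** A common zero of [f] and [g] meets both sign conditions at once, and [0 < a] makes the vector
    nonzero. *)
Lemma not_R0_tensor2 a b :
  0 < a -> 0 <= b -> f a b = 0 -> g a b = 0 -> ~ R0_tensor A.
Proof.
move=> a0 b0 fab gab; apply; exists (vec2 a b); split.
- by apply: ord2P; rewrite ?vec2_0 ?vec2_1 // ltW.
- by move=> /matrixP/(_ 0 0); rewrite vec2_0 mxE => a_eq0; rewrite a_eq0 ltxx in a0.
- by rewrite appA; apply: ord2P; rewrite ?vec2_0 ?vec2_1 !(fab, gab).
Qed.

End DimensionTwo.

Lemma not_copositive_Q_iff_R0 (R : realType) m (A : tensor R m.+1 2) :
  [/\ copositive A, Q_tensor A & ~ R0_tensor A] -> ~ copositive_Q_iff_R0 R m.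
Proof. by case=> cA QA nA /(_ 2 isT A cA)[/(_ QA)]. Qed.

(** * The tensors A and B *)

Lemma tens_app_tensA (R : realType) :
  tens_app_is (tensA R) (fun a b => a * b ^+ 2) (fun a b => b ^+ 3 - a ^+ 2 * b).
Proof.
move=> x; apply/matrixP => i j; rewrite ord1 {j}; move: i.
have l1 : lift ord0 ord0 = 1 :> 'I_2 by apply: val_inj.
by apply: ord2P; rewrite ?vec2_0 ?vec2_1 tens_appE;
  (* Each round peels off one of the three summation indices, leaving eight explicit entries. *)
  do 3![rewrite ?sum_tupleS !big_ord_recl !big_ord0];
  rewrite !sum_tuple0 !ffunE /= !l1 !big_cons !big_nil; ring.
Qed.

Lemma tens_app_tensB (R : realType) :
  tens_app_is (tensB R) (fun a b => b ^+ 2) (fun a b => b ^+ 2 - a * b).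
Proof.
move=> x; apply/matrixP => i j; rewrite ord1 {j}; move: i.
have l1 : lift ord0 ord0 = 1 :> 'I_2 by apply: val_inj.
by apply: ord2P; rewrite ?vec2_0 ?vec2_1 tens_appE;
  do 2![rewrite ?sum_tupleS !big_ord_recl !big_ord0];
  rewrite !sum_tuple0 !ffunE /= !l1 !big_cons !big_nil; ring.
Qed.

Lemma tensA_copositive_Q_not_R0 (R : realType) :
  [/\ copositive (tensA R), Q_tensor (tensA R) & ~ R0_tensor (tensA R)].
Proof.
have appA := @tens_app_tensA R; split.
- apply: (copositive2 appA) => a b a0 b0.
  suff -> : a * (a * b ^+ 2) + b * (b ^+ 3 - a ^+ 2 * b) = b ^+ 4.
    exact: exprn_ge0.
  by ring.
- apply: (Q_tensor2 appA) => p r; have [p0|p0] := leP 0 p.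
    have [r0|r0] := leP 0 r.
      by exists 0, 0; split=> //; lra.
    (* On the axis a = 0 the cube root b of -r annihilates the second component, and the first is
       p. *)
    have [|b b0 bE] := @nth_root_exists _ 2 (- r); first by lra.
    by exists 0, b; split=> //; rewrite ?bE; nra.
  (* Root of the discriminant of X^2 + r X - p^2; the positive root (d - r) / 2 serves as b^3, and
     the first equation then forces a = -p / b^2. *)
  pose d := Num.sqrt (r ^+ 2 + 4 * p ^+ 2).
  have d0 : 0 <= d by apply: sqrtr_ge0.
  have dE : d ^+ 2 = r ^+ 2 + 4 * p ^+ 2 by rewrite sqr_sqrtr //; nra.
  have rd : r < d by nra.
  have [|b b0 bE] := @nth_root_exists _ 2 ((d - r) / 2); first by lra.
  have b_neq0 : b != 0.
    by apply/eqP => b_eq0; move: bE; rewrite b_eq0 expr0n /=; lra.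
  have e1 : - p / b ^+ 2 * b ^+ 2 + p = 0 by field.
  have e2 : b ^+ 3 - (- p / b ^+ 2) ^+ 2 * b + r = 0.
    (* Clearing the denominator b^3 turns the second equation into the quadratic satisfied by
       b^3. *)
    have -> : b ^+ 3 - (- p / b ^+ 2) ^+ 2 * b + r
            = (b ^+ 3 * b ^+ 3 + r * b ^+ 3 - p ^+ 2) / b ^+ 3 by field.
    have -> : b ^+ 3 * b ^+ 3 + r * b ^+ 3 - p ^+ 2 = 0 by rewrite bE; lra.
    by rewrite mul0r.
  exists (- p / b ^+ 2), b; split; rewrite ?e1 ?e2 ?mulr0 //; split=> //.
  by rewrite divr_ge0 ?exprn_ge0 //; lra.
- by apply: (not_R0_tensor2 appA (a := 1) (b := 0)) => //; ring.
Qed.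

Lemma tensB_copositive_Q_not_R0 (R : realType) :
  [/\ copositive (tensB R), Q_tensor (tensB R) & ~ R0_tensor (tensB R)].
Proof.
have appB := @tens_app_tensB R; split.
- apply: (copositive2 appB) => a b a0 b0.
  suff -> : a * b ^+ 2 + b * (b ^+ 2 - a * b) = b ^+ 3 by exact: exprn_ge0.
  by ring.
- apply: (Q_tensor2 appB) => p r.
  (* For p <= r with p < 0, both components are made to vanish: b^2 = -p, then a b = r - p, which is
     nonnegative. For r < p with r < 0, take a = 0 and b^2 = -r, leaving p - r > 0 in the first
     component. *)
  have [pr|rp] := leP p r.
    have [p0|p0] := leP 0 p.
      by exists 0, 0; split=> //; lra.
    have [|b b0 bE] := @nth_root_exists _ 1 (- p); first by lra.
    have b_neq0 : b != 0.
      by apply/eqP => b_eq0; move: bE; rewrite b_eq0 expr0n /=; lra.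
    have ab : (r - p) / b * b = r - p by field.
    by exists ((r - p) / b), b; split; rewrite ?ab ?bE; nra.
  have [r0|r0] := leP 0 r.
    by exists 0, 0; split=> //; lra.
  have [|b b0 bE] := @nth_root_exists _ 1 (- r); first by lra.
  by exists 0, b; split=> //; rewrite ?bE; nra.
- by apply: (not_R0_tensor2 appB (a := 1) (b := 0)) => //; ring.
Qed.

(** * The tensor C *)

Fact size_blocks (T : Type) (u v : T) m (i : 'I_m.+1) :
  size (nseq (m - i) u ++ nseq i v) == m.
Proof. by rewrite size_cat !size_nseq subnK // leq_ord. Qed.

Definition blocks {T : Type} (u v : T) m (i : 'I_m.+1) : m.-tuple T :=
  Tuple (size_blocks u v i).

Lemma prod_blocks (R : comPzRingType) (T : Type) (F : T -> R) u v m (i : 'I_m.+1) :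
  \prod_(j <- blocks u v i) F j = F u ^+ (m - i) * F v ^+ i.
Proof. by rewrite big_cat /= !big_nseq !iter_mulr_1. Qed.

(** As [u] and [v] differ, the number of occurrences of [v] recovers [i]. *)
Lemma blocks_inj {T : eqType} (u v : T) m :
  u != v -> injective (blocks u v (m := m)).
Proof.
move=> uv i j /(congr1 (fun t : m.-tuple T => count_mem v t)).
rewrite /= !count_cat !count_nseq /= eqxx (negPf uv) !mul1n !mul0n !add0n.
exact: val_inj.
Qed.

Lemma idx_inj m n : injective (@idx m n).
Proof.
move=> s t st; apply: val_inj; move: st; apply: inj_map => i j [].
exact: val_inj.
Qed.

Lemma idx_blocks m n (u v : 'I_n) (i : 'I_m.+1) :
  idx (blocks u v i) = nseq (m - i) u.+1 ++ nseq i v.+1.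
Proof. by rewrite /idx map_cat !map_nseq. Qed.

Lemma idxC1E m (i : 'I_m.+1) : idxC1 m i = 1%N :: idx (blocks (0 : 'I_2) 1 i).
Proof. by rewrite idx_blocks /idxC1 subSn ?leq_ord. Qed.

(** [blocks] is indexed by the length of its second block, here the [m - i] ones, which is the value
    of [rev_ord i]. *)
Lemma idxC2E m (i : 'I_m.+1) :
  idxC2 m i = 2%N :: idx (blocks (1 : 'I_2) 0 (rev_ord i)).
Proof. by rewrite idx_blocks /idxC2 /= subSS subKn ?leq_ord. Qed.

(** In both rows the entry (-1)^i C(m, i) multiplies the monomial a^(m-i) b^i, so the binomial
    theorem applies to each. *)
Lemma tens_app_tensC (R : realType) m :
  tens_app_is (tensC R m) (fun a b => (a - b) ^+ m) (fun a b => (a - b) ^+ m).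
Proof.
move=> x; apply/matrixP => i j; rewrite ord1 {j}; move: i.
apply: ord2P; rewrite ?vec2_0 ?vec2_1 tens_appE exprBn.
- rewrite (sum_support_inj (@blocks_inj _ (0 : 'I_2) 1 m isT)) => [|t nt].
    apply: eq_bigr => i _.
    rewrite (tensC_idx1 _ (i := i)) ?idxC1E // prod_blocks.
    by rewrite -[RHS]mulr_natr; ring.
  (* For a tail outside the family the entry is zero: the leading index excludes the [idxC2]
     pattern, and injectivity of [idx] the [idxC1] pattern. *)
  rewrite tensC_other ?mul0r // => i; rewrite idxC1E idxC2E; split=> // -[] /idx_inj.
  by apply/eqP.
- have inj1 : injective (fun i : 'I_m.+1 => blocks (1 : 'I_2) 0 (rev_ord i)).
    exact: inj_comp (@blocks_inj _ (1 : 'I_2) 0 m isT) rev_ord_inj.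
  rewrite (sum_support_inj inj1) => [|t nt].
    apply: eq_bigr => i _.
    rewrite (tensC_idx2 _ (i := i)) ?idxC2E // prod_blocks.
    by rewrite /= subSS subKn ?leq_ord // -[RHS]mulr_natr; ring.
  rewrite tensC_other ?mul0r // => i; rewrite idxC1E idxC2E; split=> // -[] /idx_inj.
  by apply/eqP.
Qed.

Lemma tensC_copositive_Q_not_R0 (R : realType) m : ~~ odd m -> (0 < m)%N ->
  [/\ copositive (tensC R m), Q_tensor (tensC R m) & ~ R0_tensor (tensC R m)].
Proof.
move=> m_even m_gt0; have appC := @tens_app_tensC R m.
have m_neq0 : (m == 0%N) = false by apply/negbTE; rewrite -lt0n.
split.
- apply: (copositive2 appC) => a b a0 b0.
  by rewrite -mulrDl mulr_ge0 ?addr_ge0 // exprn_even_ge0.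
- apply: (Q_tensor2 appC) => p r.
  have root_opp c : c < 0 -> exists2 x : R, 0 <= x & x ^+ m = - c.
    move=> c0; rewrite -(prednK m_gt0); apply: nth_root_exists.
    by rewrite oppr_ge0 ltW.
  (* Both components share the value (a - b)^m, so it must cancel the smaller of p and r when that
     is negative; the variable of that component carries the root and the other is 0. *)
  have [pr|rp] := leP p r.
    have [p0|p0] := leP 0 p.
      exists 0, 0; rewrite subr0 expr0n m_neq0 !mul0r !add0r.
      by split=> //; lra.
    have [a a0 aE] := root_opp _ p0.
    by exists a, 0; rewrite subr0 aE; split=> //; lra.
  have [r0|r0] := leP 0 r.
    exists 0, 0; rewrite subr0 expr0n m_neq0 !mul0r !add0r.
    by split=> //; lra.
  have [b b0 bE] := root_opp _ r0.
  (* Evenness of [m] gives (-b)^m = b^m. *)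
  exists 0, b; rewrite sub0r exprNn -signr_odd (negPf m_even) expr0 mul1r bE.
  by split=> //; lra.
- by apply: (not_R0_tensor2 appC (a := 1) (b := 1)) => //;
    rewrite subrr expr0n m_neq0.
Qed.

Theorem mainTheorem6 (R : realType) :
  [/\ copositive (tensA R), Q_tensor (tensA R) & ~ R0_tensor (tensA R)] /\
  [/\ copositive (tensB R), Q_tensor (tensB R) & ~ R0_tensor (tensB R)] /\
  (~ copositive_Q_iff_R0 R 3 /\ ~ copositive_Q_iff_R0 R 2 /\
   ~ (forall m : nat, (2 <= m.+1)%N -> copositive_Q_iff_R0 R m)) /\
  (forall m : nat, odd m.+1 -> (3 <= m.+1)%N ->
     [/\ copositive (tensC R m), Q_tensor (tensC R m) & ~ R0_tensor (tensC R m)]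
     /\ ~ copositive_Q_iff_R0 R m).
Proof.
have HA := tensA_copositive_Q_not_R0 R.
have HB := tensB_copositive_Q_not_R0 R.
have nB := not_copositive_Q_iff_R0 HB.
split=> //; split=> //; split.
  (* The statement over all orders is refuted at [m = 2] by B. *)
  by split; [exact: not_copositive_Q_iff_R0 HA | split=> // /(_ 2 isT)].
move=> m m_even m_gt1.
have HC := @tensC_copositive_Q_not_R0 R m m_even (ltnW m_gt1).
by split=> //; exact: not_copositive_Q_iff_R0 HC.
Qed.
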